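(* Let $n_1\ge1$, $n_2\ge2$ be integers, $n=n_1+n_2$, $\mathrm{rk}=n_1+2$, let $r\in\mathbb{N}$, and let $\delta_r^{\mathrm{rk}-1}$ be a finite subset of the standard simplex $\Delta_=^{\mathrm{rk}-1}$. For the symmetric cone $\mathbb{E}_+=\mathbb{R}_+^{n_1}\times\mathbb{L}^{n_2}$, the outer approximation $\mathcal{O}_r^n(\mathbb{E}_+)$ induced by $\delta_r^{\mathrm{rk}-1}$ satisfies $$\mathcal{O}_r^n(\mathbb{E}_+)=\bigcap_{\boldsymbol{x}\in\delta_r^{\mathrm{rk}-1}}\left\{\boldsymbol{A}\in\mathbb{S}^n\ \middle|\ \text{there exists }t_{\boldsymbol{x}}\in\mathbb{R}\text{ such that }\boldsymbol{N}(\boldsymbol{x},\boldsymbol{A})-t_{\boldsymbol{x}}\begin{pmatrix}1&\boldsymbol{0}\\\boldsymbol{0}&-\boldsymbol{I}_{n_2-1}\end{pmatrix}\in\mathbb{S}_+^{n_2}\right\}.$$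
   Context: $\mathbb{S}^k$ (resp. $\mathbb{S}_+^k$) is the set of real symmetric (resp. positive semidefinite) $k\times k$ matrices, $S^{k}$ the unit sphere in $\mathbb{R}^{k+1}$, $\mathbb{L}^{n_2}=\{(x_1,\boldsymbol{x}_{2:n_2})\in\mathbb{R}^{n_2}\mid x_1\ge\|\boldsymbol{x}_{2:n_2}\|_2\}$ the second-order cone, $\Delta_=^{k-1}=\{\boldsymbol{x}\in\mathbb{R}_+^k\mid\sum_i x_i=1\}$. Definition of the left-hand side. Let $\mathcal{O}_r^{\mathrm{rk}}=\bigcap_{\boldsymbol{x}\in\delta_r^{\mathrm{rk}-1}}\{\boldsymbol{B}\in\mathbb{S}^{\mathrm{rk}}\mid\boldsymbol{x}^\top\boldsymbol{B}\boldsymbol{x}\ge0\}$. For $\boldsymbol{v}\in S^{n_2-2}$ let $c_i(\boldsymbol{v})=(\boldsymbol{e}_i,\boldsymbol{0}_{n_2})\in\mathbb{R}^n$ for $i=1,\dots,n_1$, $c_{n_1+1}(\boldsymbol{v})=(\boldsymbol{0}_{n_1},1/2,\boldsymbol{v}/2)$, $c_{n_1+2}(\boldsymbol{v})=(\boldsymbol{0}_{n_1},1/2,-\boldsymbol{v}/2)$ (these are Jordan frames of the Euclidean Jordan algebra associated with $\mathbb{R}_+^{n_1}\times\mathbb{L}^{n_2}$, and they exhaust all its Jordan frames up to ordering). Then $\mathcal{O}_r^n(\mathbb{E}_+)$ is the set of $\boldsymbol{A}\in\mathbb{S}^n$ such that for every $\boldsymbol{v}\in S^{n_2-2}$ the matrix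 $(c_i(\boldsymbol{v})^\top\boldsymbol{A}\,c_j(\boldsymbol{v}))_{i,j=1}^{\mathrm{rk}}$ belongs to $\mathcal{O}_r^{\mathrm{rk}}$. Definition of $\boldsymbol{N}$. Partition $$\boldsymbol{A}=\begin{pmatrix}\boldsymbol{A}^{(11)}&\boldsymbol{A}^{(121)}&(\boldsymbol{A}^{(122)})^\top\\(\boldsymbol{A}^{(121)})^\top&A^{(2121)}&(\boldsymbol{A}^{(2122)})^\top\\\boldsymbol{A}^{(122)}&\boldsymbol{A}^{(2122)}&\boldsymbol{A}^{(2222)}\end{pmatrix}$$ with $\boldsymbol{A}^{(11)}\in\mathbb{S}^{n_1}$, $\boldsymbol{A}^{(121)}\in\mathbb{R}^{n_1}$, $\boldsymbol{A}^{(122)}\in\mathbb{R}^{(n_2-1)\times n_1}$, $A^{(2121)}\in\mathbb{R}$, $\boldsymbol{A}^{(2122)}\in\mathbb{R}^{n_2-1}$, $\boldsymbol{A}^{(2222)}\in\mathbb{S}^{n_2-1}$. For $\boldsymbol{x}=(\boldsymbol{x}_1,x_{21},x_{22})\in\mathbb{R}^{n_1}\times\mathbb{R}\times\mathbb{R}$, $$\boldsymbol{N}(\boldsymbol{x},\boldsymbol{A})=\begin{pmatrix}N^{(11)}&(\boldsymbol{N}^{(21)})^\top\\\boldsymbol{N}^{(21)}&\boldsymbol{N}^{(22)}\end{pmatrix}\in\mathbb{S}^{n_2},$$ where $N^{(11)}=4\boldsymbol{x}_1^\top\boldsymbol{A}^{(11)}\boldsymbol{x}_1+4(x_{21}+x_{22})\boldsymbol{x}_1^\top\boldsymbol{A}^{(121)}+(x_{21}+x_{22})^2A^{(2121)}$,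 $\boldsymbol{N}^{(21)}=2(x_{21}-x_{22})\boldsymbol{A}^{(122)}\boldsymbol{x}_1+(x_{21}^2-x_{22}^2)\boldsymbol{A}^{(2122)}$, $\boldsymbol{N}^{(22)}=(x_{21}-x_{22})^2\boldsymbol{A}^{(2222)}$. *)

(* Defs.v *)
From mathcomp Require Import all_boot all_order all_algebra.
From mathcomp Require Import all_classical all_reals.

Set Implicit Arguments.
Unset Strict Implicit.
Unset Printing Implicit Defensive.

Import Order.TTheory GRing.Theory Num.Theory.

Local Open Scope classical_set_scope.
Local Open Scope ring_scope.

(* Vectors are columns.  Throughout, m stands for n2 - 1, so that R^n2 is
   'cV_(1 + m) and R^n = R^n1 x R x R^(n2 - 1) is 'cV_(n1 + (1 + m)); the block
   decompositions are then those of matrix.v. *)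

Section Basics.
Variable R : realType.

Definition symmx k : set 'M[R]_k := [set B | B \is symmetricmx].

Definition bform k (x : 'cV[R]_k) (B : 'M[R]_k) (y : 'cV[R]_k) : R :=
  (x^T *m B *m y) 0 0.

Definition psdmx k : set 'M[R]_k :=
  [set B | symmx B /\ forall x : 'cV[R]_k, 0 <= bform x B x].

Definition std_simplex k : set 'cV[R]_k :=
  [set x | (forall i, 0 <= x i 0) /\ \sum_i x i 0 = 1].

(* The Euclidean norm; `|x| on matrices is the max norm. *)
Definition norm2 k (x : 'cV[R]_k) : R := Num.sqrt (\sum_i x i 0 ^+ 2).

Definition unit_sphere k : set 'cV[R]_k := [set x | norm2 x = 1].

End Basics.

Arguments std_simplex : clear implicits.
Arguments psdmx : clear implicits.
Arguments symmx : clear implicits.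
Arguments unit_sphere : clear implicits.

Section OuterApproximation.
Variable R : realType.

(* Intersecting with the symmetric matrices explicitly makes an intersection
   indexed by the empty set equal to the ambient space S^k. *)
Definition outer_orthant k (D : set 'cV[R]_k) : set 'M[R]_k :=
  symmx R k `&` \bigcap_(x in D) [set B | 0 <= bform x B x].

Variables n1 m : nat.

(* The Jordan frame c_1(v), ..., c_(n1+2)(v) of R_+^n1 x L^(1 + m). *)
Definition frame (v : 'cV[R]_m) (i : 'I_(n1 + 2)) : 'cV[R]_(n1 + (1 + m)) :=
  match fintype.split i with
  | inl j => col_mx (delta_mx j 0) 0
  | inr k => col_mx 0 (col_mx (2^-1)%:M
                         (if k == 0 then 2^-1 *: v else - (2^-1 *: v)))
  end.

Definition frame_mx (v : 'cV[R]_m) (A : 'M[R]_(n1 + (1 + m))) :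
    'M[R]_(n1 + 2) :=
  \matrix_(i, j) bform (frame v i) A (frame v j).

Definition outer_approx (D : set 'cV[R]_(n1 + 2)) :
    set 'M[R]_(n1 + (1 + m)) :=
  [set A | symmx R _ A /\
    forall v, unit_sphere R m v -> outer_orthant D (frame_mx v A)].

Definition Nmx (x : 'cV[R]_(n1 + 2)) (A : 'M[R]_(n1 + (1 + m))) :
    'M[R]_(1 + m) :=
  let x1 := usubmx x in
  let x21 := dsubmx x 0 0 in
  let x22 := dsubmx x 1 0 in
  let A11 : 'M_n1 := ulsubmx A in
  let A121 : 'cV_n1 := lsubmx (ursubmx A) in
  let A122 : 'M_(m, n1) := dsubmx (dlsubmx A) in
  let A2121 : 'M_1 := ulsubmx (drsubmx A) in
  let A2122 : 'cV_m := dlsubmx (drsubmx A) in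
  let A2222 : 'M_m := drsubmx (drsubmx A) in
  let N11 := 4 *: (x1^T *m A11 *m x1)
             + (4 * (x21 + x22)) *: (x1^T *m A121)
             + (x21 + x22) ^+ 2 *: A2121 in
  let N21 := (2 * (x21 - x22)) *: (A122 *m x1)
             + (x21 ^+ 2 - x22 ^+ 2) *: A2122 in
  let N22 := (x21 - x22) ^+ 2 *: A2222 in
  block_mx N11 N21^T N21 N22.

End OuterApproximation.

Arguments outer_approx : clear implicits.
Arguments Nmx {R n1 m} x A.

Definition lorentz_mx (R : realType) (m : nat) : 'M[R]_(1 + m) :=
  block_mx 1%:M 0 0 (- 1%:M).

(* Main.v *)
Require Import Defs.
From mathcomp Require Import all_boot all_order all_algebra.
From mathcomp Require Import all_classical all_reals.
From mathcomp Require Import ring lra.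

Set Implicit Arguments.
Unset Strict Implicit.
Unset Printing Implicit Defensive.

Import Order.TTheory GRing.Theory Num.Theory.

Local Open Scope classical_set_scope.
Local Open Scope ring_scope.

(** Scaled by 4, the quadratic form of the frame matrix at x is the value of
    N(x, A) at (1, v), so A lies in the outer approximation iff every N(x, A)
    is nonnegative on the vectors (1, v) with v a unit vector, i.e. (by
    homogeneity) on the null cone of the Lorentz form.  By the S-lemma with an
    equality constraint this is the existence of t_x.  The multiplier is the
    supremum of the ratios Q(z)/J(z) over J(z) < 0: it does not exceed
    any ratio Q(y)/J(y) with J(y) > 0, as one sees in the plane spanned by
    y and z. *)

(** * Quadratic forms and the S-lemma with an equality constraint *)

Section BilinearForms.
Variable R : realType.

Lemma mx11_tr (M : 'M[R]_1) : M^T = M.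
Proof. by apply/matrixP => i j; rewrite mxE !ord1. Qed.

Lemma symmx_trP k (B : 'M[R]_k) : symmx R k B <-> B^T = B.
Proof.
rewrite /symmx /=; split=> [/is_hermitianmxP|BT].
  by rewrite expr0 scale1r map_mx_id // => <-.
by apply/is_hermitianmxP; rewrite expr0 scale1r map_mx_id.
Qed.

Lemma bformDl k (B : 'M[R]_k) x y z :
  bform (x + y) B z = bform x B z + bform y B z.
Proof. by rewrite /bform linearD /= !mulmxDl mxE. Qed.

Lemma bformZl k (B : 'M[R]_k) a x z : bform (a *: x) B z = a * bform x B z.
Proof. by rewrite /bform linearZ /= -!scalemxAl mxE. Qed.

Lemma bformC k (B : 'M[R]_k) x y : B^T = B -> bform x B y = bform y B x.
Proof.
by move=> BT; rewrite /bform -[x^T *m B *m y]mx11_tr !trmx_mul trmxK BT mulmxA.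
Qed.

Lemma bform_comb k (B : 'M[R]_k) (b : R) x y : B^T = B ->
  bform (x + b *: y) B (x + b *: y) =
  bform x B x + 2 * b * bform x B y + b ^+ 2 * bform y B y.
Proof.
move=> BT; rewrite bformDl bformZl ![bform _ B (_ + _)]bformC//.
by rewrite !bformDl !bformZl (bformC y x BT); ring.
Qed.

Lemma bformB k (B C : 'M[R]_k) t x :
  bform x (B - t *: C) x = bform x B x - t * bform x C x.
Proof. by rewrite /bform mulmxBr mulmxBl -scalemxAr -scalemxAl !mxE. Qed.

Lemma bform_congr k l (F : 'M[R]_(k, l)) (B : 'M[R]_k) x :
  bform x (F^T *m B *m F) x = bform (F *m x) B (F *m x).
Proof. by rewrite /bform trmx_mul !mulmxA. Qed.

(* The plane spanned by y and z contains two null vectors y + b1 z and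
   y + b2 z of J with b1 > 0 > b2; in the combination of the values of Q at
   these with weights - b2 and b1 the cross terms cancel. *)
Lemma null_nonneg_ratio k (Q J : 'M[R]_k) y z :
    Q^T = Q -> J^T = J ->
    (forall x, bform x J x = 0 -> 0 <= bform x Q x) ->
    0 < bform y J y -> bform z J z < 0 ->
  bform z Q z / bform z J z <= bform y Q y / bform y J y.
Proof.
move=> QT JT Qnull; set p := bform y J y => p0 zJ0.
set n := - bform z J z; have n0 : 0 < n by rewrite oppr_gt0.
have zJE : bform z J z = - n by rewrite opprK.
(* At [n *: y + (s + e) *: z] the form [J] takes the value n (p n + s^2 - e^2), so the null vectors
   of this shape are those with e = d or e = -d. Dividing by [n] gives b1 = (s + d) / n and b2 = (s
   - d) / n, whose signs follow from |s| < d. *)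
pose s := bform y J z; pose d := Num.sqrt (s ^+ 2 + p * n).
have d2 : d ^+ 2 = s ^+ 2 + p * n.
  by rewrite sqr_sqrtr// addr_ge0 ?sqr_ge0// mulr_ge0// ltW.
have d0 : 0 < d by rewrite sqrtr_gt0 ltr_wpDl ?sqr_ge0// mulr_gt0.
have sd : `|s| < d.
  rewrite -(ltr_pXn2r (n := 2)) ?nnegrE ?normr_ge0 ?(ltW d0)//.
  by rewrite real_normK ?num_real// d2 ltrDl mulr_gt0.
have {sd} [sd1 sd2] : - d < s /\ s < d by move: sd; rewrite ltr_norml => /andP[].
have nn0 : n != 0 by rewrite gt_eqF.
have null (e : R) : e ^+ 2 = d ^+ 2 ->
    0 <= bform (n *: y + (s + e) *: z) Q (n *: y + (s + e) *: z).
  move=> e2; apply: Qnull; rewrite bform_comb// bformZl bformC// bformZl.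
  rewrite bformZl -/p -/s zJE; rewrite d2 in e2.
  rewrite (_ : _ + _ = n * (p * n + s ^+ 2 - e ^+ 2)); last by ring.
  by rewrite e2; ring.
have := null d erefl; have := null (- d) (sqrrN d).
rewrite !bform_comb// !bformZl ![bform y Q (_ *: y)]bformC// !bformZl.
set a := bform y Q y; set b := bform y Q z; set c := bform z Q z => h2 h1.
have : 0 <= (d - s) * (n * (n * a) + 2 * (s + d) * (n * b) + (s + d) ^+ 2 * c)
   + (s + d) * (n * (n * a) + 2 * (s - d) * (n * b) + (s - d) ^+ 2 * c).
  by rewrite addr_ge0// mulr_ge0//; lra.
have -> : (d - s) * (n * (n * a) + 2 * (s + d) * (n * b) + (s + d) ^+ 2 * c)
   + (s + d) * (n * (n * a) + 2 * (s - d) * (n * b) + (s - d) ^+ 2 * c)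
   = 2 * d * (n * n * a + (d ^+ 2 - s ^+ 2) * c) by ring.
rewrite d2 (_ : _ * _ = 2 * d * n * (n * a + p * c)); last by ring.
rewrite pmulr_rge0 ?mulr_gt0// => key.
rewrite zJE invrN mulrN -mulNr ler_pdivrMr// mulrAC ler_pdivlMr//; lra.
Qed.

Lemma s_lemma_eq k (Q J : 'M[R]_k) y0 z0 :
    Q^T = Q -> J^T = J -> 0 < bform y0 J y0 -> bform z0 J z0 < 0 ->
    (forall x, bform x J x = 0 -> 0 <= bform x Q x) ->
  exists t, forall x, 0 <= bform x (Q - t *: J) x.
Proof.
move=> QT JT y0J z0J Qnull.
pose T := [set bform z Q z / bform z J z | z in [set z | bform z J z < 0]].
have Tub y : 0 < bform y J y -> ubound T (bform y Q y / bform y J y).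
  by move=> yJ _ [z /= zJ <-]; exact: null_nonneg_ratio.
(* [z0] makes [T] nonempty and [y0] provides an upper bound, so [sup T] is a genuine least upper
   bound and not a default value. *)
have Tsup : has_sup T.
  split; first by exists (bform z0 Q z0 / bform z0 J z0), z0.
  by exists (bform y0 Q y0 / bform y0 J y0); exact: Tub.
exists (sup T) => x; rewrite bformB subr_ge0.
(* For negative J(x) the ratio at [x] lies in [T]; for positive J(x) it is an upper bound of [T]; on
   the null cone the multiplier disappears. *)
have [xJ|xJ|xJ] := ltrgtP (bform x J x) 0.
- rewrite -ler_ndivrMr//; apply: sup_upper_bound => //; by exists x.
- rewrite -ler_pdivlMr//; apply: ge_sup; [exact: Tsup.1 | exact: Tub].
- by rewrite xJ mulr0; exact: Qnull.
Qed.

End BilinearForms.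

(** * The Lorentz form and its null cone *)

Section LorentzForm.
Variable R : realType.

(** For unit [v] these vectors form the slice of the Lorentz null cone at first coordinate 1. *)
Definition lift1 m (v : 'cV[R]_m) : 'cV[R]_(1 + m) := col_mx 1%:M v.

Lemma lorentz_mx_tr m : (lorentz_mx R m)^T = lorentz_mx R m.
Proof. by rewrite tr_block_mx !trmx0 linearN /= !trmx1. Qed.

Lemma bform_lorentz m (a : 'M[R]_1) (v : 'cV[R]_m) :
  bform (col_mx a v) (lorentz_mx R m) (col_mx a v) =
  a 0 0 ^+ 2 - \sum_i v i 0 ^+ 2.
Proof.
rewrite /bform tr_col_mx mul_row_block !mulmx0 addr0 add0r mulmx1 mulmxN mulmx1.
rewrite mul_row_col mulNmx mxE [in X in _ + X]mxE !mxE big_ord1 mxE; congr (_ - _).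
by apply: eq_bigr => i _; rewrite mxE.
Qed.

Lemma unit_sphereP m (v : 'cV[R]_m) :
  unit_sphere R m v <-> \sum_i v i 0 ^+ 2 = 1.
Proof.
rewrite /unit_sphere /norm2 /=; split=> [h|->]; last exact: sqrtr1.
rewrite -[LHS]sqr_sqrtr ?h ?expr1n//.
by apply: sumr_ge0 => i _; exact: sqr_ge0.
Qed.

(** The term in [t] vanishes at [lift1 v] for unit [v], which gives one direction. For the other,
    every null vector is a multiple of such a vector, so the S-lemma applies. *)
Lemma s_lemma_sphere m (Q : 'M[R]_(1 + m)) : (0 < m)%N -> Q^T = Q ->
  (exists t, psdmx R (1 + m) (Q - t *: lorentz_mx R m)) <->
  (forall v, unit_sphere R m v -> 0 <= bform (lift1 v) Q (lift1 v)).
Proof.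
case: m Q => // m Q _ QT; split=> [[t [_ psd]] v /unit_sphereP v1|Qs].
  have := psd (lift1 v); rewrite bformB bform_lorentz v1 mxE eqxx.
  by rewrite expr1n subrr mulr0 subr0.
have y0J : 0 < bform (col_mx 1%:M 0) (lorentz_mx R m.+1) (col_mx 1%:M 0).
  by rewrite bform_lorentz mxE eqxx expr1n big1 ?subr0// => i _; rewrite mxE expr0n.
(* A vector on which the form is negative needs a coordinate in the second block; it exists because
   [m] is positive. *)
have z0J : bform (col_mx 0 (delta_mx 0 0)) (lorentz_mx R m.+1)
    (col_mx 0 (delta_mx 0 0)) < 0.
  rewrite bform_lorentz mxE expr0n /= sub0r (bigD1 ord0)//= big1 => [|i i0].
    by rewrite mxE eqxx expr1n addr0 oppr_lt0.
  by rewrite mxE (negPf i0) expr0n.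
have [x|t psd] := s_lemma_eq QT (lorentz_mx_tr m.+1) y0J z0J; last first.
  exists t; split=> //; apply/symmx_trP.
  by rewrite linearB linearZ /= QT lorentz_mx_tr.
rewrite -[x]vsubmxK; move: (usubmx x) (dsubmx x) => a w.
rewrite bform_lorentz => /eqP; rewrite subr_eq0 => /eqP aw.
(* If the first coordinate of a null vector is 0, the squares in [w] sum to 0 and the vector is
   zero. Otherwise dividing by that coordinate, of either sign, gives (1, v) with [v] a unit
   vector. *)
have [a0|a0] := eqVneq (a 0 0) 0.
  have -> : col_mx a w = 0.
    have -> : a = 0 by apply/matrixP => i j; rewrite !ord1 a0 mxE.
    have -> : w = 0; last by rewrite col_mx0.
    apply/matrixP => i j; rewrite ord1 mxE; apply/eqP.
    rewrite -sqrf_eq0; move: aw; rewrite a0 expr0n /= => /esym/psumr_eq0P.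
    by move=> ->// l _; exact: sqr_ge0.
  by rewrite -(scale0r (0 : 'cV_(1 + m.+1))) bformZl mul0r.
have -> : col_mx a w = a 0 0 *: lift1 ((a 0 0)^-1 *: w).
  rewrite scale_col_mx scalerA divff// scale1r; congr col_mx.
  by apply/matrixP => i j; rewrite !ord1 !mxE eqxx mulr1.
rewrite bformZl bformC// bformZl mulrA -expr2 mulr_ge0 ?sqr_ge0//.
apply: Qs; apply/unit_sphereP.
under eq_bigr => i _ do rewrite mxE exprMn.
by rewrite -mulr_sumr -aw exprVn mulVf// sqrf_eq0.
Qed.

End LorentzForm.

(** * From the frame matrix to N(x, A) *)

Section Frame.
Variables (R : realType) (n1 m : nat).

(** With the frame vectors as columns, [frame_mx] becomes a congruence transform of [A]. *)
Definition frame_cols (v : 'cV[R]_m) : 'M[R]_(n1 + (1 + m), n1 + 2) :=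
  \matrix_(i, j) frame v j i 0.

Lemma frame_mxE (v : 'cV[R]_m) (A : 'M[R]_(n1 + (1 + m))) :
  frame_mx v A = (frame_cols v)^T *m A *m frame_cols v.
Proof.
apply/matrixP => i j; rewrite !mxE /bform !mxE; apply: eq_bigr => k _.
rewrite !mxE; congr (_ * _); apply: eq_bigr => l _; by rewrite !mxE.
Qed.

Lemma frame_lshift (v : 'cV[R]_m) (i : 'I_n1) :
  frame v (lshift 2 i) = col_mx (delta_mx i 0) 0.
Proof. by rewrite /frame (unsplitK (inl i)). Qed.

Lemma frame_rshift (v : 'cV[R]_m) (k : 'I_2) :
  frame v (rshift n1 k) = col_mx 0 (col_mx (2^-1)%:M
    (if k == 0 then 2^-1 *: v else - (2^-1 *: v))).
Proof. by rewrite /frame (unsplitK (inr k)). Qed.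

(** The factor 1/2 is pulled out because its square accounts for the 4 in [bform_frame]. *)
Lemma frame_cols_mul (v : 'cV[R]_m) (x : 'cV[R]_(n1 + 2)) :
  frame_cols v *m x =
  2^-1 *: col_mx (2 *: usubmx x)
    (col_mx (dsubmx x 0 0 + dsubmx x 1 0)%:M
            ((dsubmx x 0 0 - dsubmx x 1 0) *: v)).
Proof.
have -> : frame_cols v *m x = \sum_j x j 0 *: frame v j.
  apply/matrixP => i j; rewrite ord1 mxE summxE; apply: eq_bigr => l _.
  by rewrite !mxE mulrC.
rewrite big_split_ord /=.
(* The first [n1] frame vectors are standard basis vectors, so they reproduce the upper part of
   [x]. *)
rewrite [X in X + _ = _](_ : _ = col_mx (usubmx x) 0); last first.
  under eq_bigr => i _ do rewrite frame_lshift scale_col_mx scaler0.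
  apply/matrixP => i j; rewrite summxE ord1 -[i]splitK.
  case: (fintype.split i) => k /=.
    rewrite col_mxEu (bigD1 k)//= big1 => [|l lk]; rewrite col_mxEu !mxE.
      by rewrite !eqxx mulr1 addr0.
    by rewrite eq_sym (negPf lk) mulr0.
  by rewrite col_mxEd mxE big1// => l _; rewrite col_mxEd mxE.
rewrite !big_ord_recl big_ord0 addr0 !frame_rshift /=.
rewrite !scale_col_mx !add_col_mx !scaler0 !addr0 add0r !mxE.
congr col_mx; first by rewrite scalerA mulVf ?scale1r ?pnatr_eq0.
have -> : lift ord0 ord0 = 1 :> 'I_2 by apply: val_inj.
congr col_mx.
  by apply/matrixP => i j; rewrite !ord1 !mxE eqxx !mulr1n; field.
by rewrite scalerN -scalerBl !scalerA; congr (_ *: _); ring.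
Qed.

Lemma Nmx_tr (x : 'cV[R]_(n1 + 2)) (A : 'M[R]_(n1 + (1 + m))) :
  A^T = A -> (Nmx x A)^T = Nmx x A.
Proof.
move=> AT; rewrite /Nmx tr_block_mx trmxK mx11_tr linearZ /=.
by rewrite !trmx_drsub AT.
Qed.

(** Both sides expand by blocks into the same polynomial in the scalars b and c (the last two
    entries of [x]) and in 1x1 products of the blocks with x1 and [v]. *)
Lemma bform_frame (v : 'cV[R]_m) (x : 'cV[R]_(n1 + 2))
    (A : 'M[R]_(n1 + (1 + m))) :
  A^T = A ->
  4 * bform x (frame_mx v A) x = bform (lift1 v) (Nmx x A) (lift1 v).
Proof.
move=> AT; rewrite frame_mxE bform_congr frame_cols_mul bformZl.
rewrite bformC// bformZl /Nmx.
set A11 := ulsubmx A; set P := lsubmx (ursubmx A).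
set S := dsubmx (dlsubmx A); set a := ulsubmx (drsubmx A).
set q := dlsubmx (drsubmx A); set C := drsubmx (drsubmx A).
(* Symmetry of [A] expresses every block through the six that enter [Nmx]. *)
have AE : A = block_mx A11 (row_mx P S^T) (col_mx P^T S) (block_mx a q^T q C).
  rewrite -[LHS]submxK; congr block_mx.
  - by rewrite -[LHS]hsubmxK /S trmx_dsub trmx_dlsub AT.
  - by rewrite -[LHS]vsubmxK /P trmx_lsub trmx_ursub AT.
  - by rewrite -[LHS]submxK /q trmx_dlsub trmx_drsub AT.
rewrite [in LHS]AE; move: (usubmx x) (dsubmx x 0 0) (dsubmx x 1 0) => x1 b c.
clearbody A11 P S a q C => {AE AT x A}.
rewrite /bform !tr_col_mx !(mul_row_block, mul_row_col, mul_mx_row, mul_col_mx).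
rewrite add_row_mx mul_row_col !tr_scalar_mx !mul1mx !mulmx1.
rewrite !(linearZ, linearD) /= !(mulmxDl, mulmxDr).
rewrite !(mul_scalar_mx, mul_mx_scalar) -!(scalemxAl, scalemxAr) !trmx_mul !mulmxA.
(* A 1x1 product equals its transpose; this merges the mirror-image cross terms before the
   comparison of scalars. *)
have -> : P^T *m x1 = x1^T *m P by rewrite -[LHS]mx11_tr trmx_mul trmxK.
have -> : q^T *m v = v^T *m q by rewrite -[LHS]mx11_tr trmx_mul trmxK.
have -> : x1^T *m S^T *m v = v^T *m S *m x1.
  by rewrite -[LHS]mx11_tr !trmx_mul !trmxK mulmxA.
move: (x1^T *m A11 *m x1) (x1^T *m P) (v^T *m q) (v^T *m S *m x1).
move: (v^T *m C *m v) => k5 k1 k2 k3 k4; rewrite !mxE.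
by field.
Qed.

End Frame.

Theorem mainTheorem8 (R : realType) (n1 n2 : nat)
    (hn1 : (1 <= n1)%N) (hn2 : (2 <= n2)%N)
    (r : nat) (delta : nat -> set 'cV[R]_(n1 + 2))
    (delta_fin : finite_set (delta r))
    (delta_sub : delta r `<=` std_simplex R (n1 + 2)) :
  outer_approx R n1 n2.-1 (delta r) =
  symmx R (n1 + (1 + n2.-1)) `&`
  \bigcap_(x in delta r)
    [set A : 'M[R]_(n1 + (1 + n2.-1)) |
      exists t : R, psdmx R (1 + n2.-1) (Nmx x A - t *: lorentz_mx R n2.-1)].
Proof.
have m0 : (0 < n2.-1)%N by case: n2 hn2 => [|[]].
have bformN A v x (AT : A^T = A) :
    (0 <= bform x (frame_mx v A) x) = (0 <= bform (lift1 v) (Nmx x A) (lift1 v)).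
  by rewrite -bform_frame// pmulr_rge0.
(* For each fixed [x], [s_lemma_sphere] trades the condition over all unit [v] for the existence of
   [t]; beyond that, only the quantifiers over [v] and [x] are swapped. *)
apply/seteqP; split=> A [] Asym AP; have AT := (symmx_trP A).1 Asym; split=> //.
  move=> x xD; apply/(s_lemma_sphere m0 (Nmx_tr x AT)) => v /AP[_ /(_ x xD)] /=.
  by rewrite bformN.
move=> v v1; split=> [|x xD /=].
  (* Membership in [outer_orthant] includes symmetry of the frame matrix, inherited from [A] by
     congruence. *)
  by apply/symmx_trP; rewrite frame_mxE !trmx_mul trmxK AT mulmxA.
rewrite bformN//; move: (AP x xD) v v1.
by move/(s_lemma_sphere m0 (Nmx_tr x AT)).
Qed.
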